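(* Let $q$ be a prime power, and let $n, k, m$ be positive integers such that $k < n$, $m \leq q^k$ and $n$ is divisible by $k$. Then $$K(q,n,k,m) \geq \frac{1}{2^{n/k}}\, m^{n/k}.$$
   Context: $\mathbb{F}_q$ is the finite field with $q$ elements. For integers $1 \leq k < n$ and $m \geq 1$, a subset $S \subseteq \mathbb{F}_q^n$ is a $(k,m)$-Furstenberg set if for each $k$-dimensional linear subspace $W$ of $\mathbb{F}_q^n$ there is a translate of $W$ that intersects $S$ in at least $m$ points. For $1 \leq k < n$ and $m \leq q^k$, $K(q,n,k,m)$ denotes the least $t$ such that there exists a $(k,m)$-Furstenberg set in $\mathbb{F}_q^n$ of cardinality $t$. *)

(* Defs.v *)
From HB Require Import structures.
From mathcomp Require Import all_boot all_order all_algebra all_field.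

Set Implicit Arguments.
Unset Strict Implicit.
Unset Printing Implicit Defensive.

Import GRing.Theory.
Local Open Scope ring_scope.

(* The library gives {vspace vT} only a choiceType structure. Over a finite
   field a subspace of F^n is encoded by a matrix over F, so {vspace 'rV[F]_n}
   is finite and quantification over it is boolean. *)
HB.instance Definition _ (F : finFieldType) (n : nat) :
    isCountable {vspace 'rV[F]_n} :=
  CanIsCountable (@VectorInternalTheory.vs2mxK F 'rV[F]_n).
HB.instance Definition _ (F : finFieldType) (n : nat) :
    isFinite {vspace 'rV[F]_n} :=
  CanIsFinite (@VectorInternalTheory.vs2mxK F 'rV[F]_n).

Definition translate (F : finFieldType) (n : nat)
    (W : {vspace 'rV[F]_n}) (v : 'rV[F]_n) : {set 'rV[F]_n} :=
  [set v + w | w in W].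

Definition furstenberg (F : finFieldType) (n k m : nat)
    (S : {set 'rV[F]_n}) : bool :=
  [forall W : {vspace 'rV[F]_n}, (\dim W == k) ==>
    [exists v : 'rV[F]_n, (m <= #|translate W v :&: S|)%N]].

(* The default value [set: _] of the arg min is itself a (k, m)-Furstenberg set
   when m <= #|F| ^ k, so that the minimum is a genuine one in that range:
   see furstenbergT and furstenberg_numP. *)
Definition furstenberg_num (F : finFieldType) (n k m : nat) : nat :=
  #|[arg min_(S < [set: 'rV[F]_n] | furstenberg k m S) #|S|]|.

Lemma card_translate (F : finFieldType) (n : nat)
    (W : {vspace 'rV[F]_n}) (v : 'rV[F]_n) :
  #|translate W v| = (#|F| ^ \dim W)%N.
Proof.
rewrite card_imset; last exact: addrI.
exact: (@card_vspace F 'rV[F]_n (Vector.on 'rV[F]_n) W).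
Qed.

Lemma furstenbergT (F : finFieldType) (n k m : nat) :
  (m <= #|F| ^ k)%N -> furstenberg k m [set: 'rV[F]_n].
Proof.
move=> le_m; apply/forallP => W; apply/implyP => /eqP dimW.
by apply/existsP; exists 0; rewrite setIT card_translate dimW.
Qed.

Lemma furstenberg_numP (F : finFieldType) (n k m : nat) :
    (m <= #|F| ^ k)%N ->
  (exists2 S : {set 'rV[F]_n}, furstenberg k m S &
     #|S| = furstenberg_num F n k m) /\
  (forall S : {set 'rV[F]_n}, furstenberg k m S ->
     (furstenberg_num F n k m <= #|S|)%N).
Proof.
move=> /(@furstenbergT F n) fT; rewrite /furstenberg_num.
by case: arg_minnP => // S fS minS; split => //; exists S.
Qed.

(* Main.v *)
From HB Require Import structures.
Require Import Defs.
From mathcomp Require Import all_boot all_order all_algebra all_fingroup.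
From mathcomp Require Import all_field zify.
Import GRing.Theory Num.Theory.
Local Open Scope ring_scope.
Set Implicit Arguments.
Unset Strict Implicit.
Unset Printing Implicit Defensive.

(** Write n = N * k and let K be the extension of F of degree k. As vector
    spaces over F, F^n and K^N are isomorphic, and every line of K^N through
    the origin is a subspace of dimension k over F. A (k, m)-Furstenberg set
    of F^n is therefore carried to a subset S of K^N such that every direction
    has a K-line meeting S in at least m points, and it is enough to show
    (m / 2)^N <= #|S| ([line_furstenberg_bound]).

    This is the method of multiplicities. Put q = #|K|, l = m * N and
    M = N * (q - 1 + m), and count coefficients against conditions: if #|S|
    were smaller, there would be a nonzero polynomial p in N variables, of
    degree d < l * q, all of whose Hasse derivatives of order < M vanish on S.
    Let H be its homogeneous part of degree d. Given b <> 0, take the line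
    a + t b that meets S in m points. A Hasse derivative of p of order w < l,
    restricted to this line, is a polynomial in t of degree at most d - w that
    vanishes to order M - w at m points; since d - w < (M - w) * m it is zero,
    and its coefficient of degree d - w is the same Hasse derivative of H at b
    ([hasse_top_eq0]). Hence H vanishes to order l everywhere on K^N.

    A nonzero homogeneous polynomial of degree d < l * q cannot do so
    ([grid_hasse_eq0]). By Hermite interpolation in one variable, there is for
    each a a linear form on univariate polynomials that kills X^j for j < a,
    is 1 on X^a, and only uses Hasse derivatives of order at most a / q at the
    points of K ([hermite_dual]). The tensor product of the forms for the
    exponents of a monomial of degree d picks the coefficient of this monomial
    in H and only uses Hasse derivatives of order at most d / q < l.

    Comparing the numbers of coefficients and of conditions gives
    (m * N * q)^N <= #|S| * (M + N - 1)^N, and M + N - 1 < 2 * N * q because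
    m <= q. *)

(** * Hasse derivatives *)

Lemma bin_trinomial (a b c : nat) :
  ('C(a, b) * 'C(a - b, c) = 'C(a, b + c) * 'C(b + c, b))%N.
Proof.
have [le|gt] := leqP (b + c) a; last first.
  rewrite (bin_small gt) mul0n; have [leb|gtb] := leqP b a.
    by rewrite [X in (_ * X)%N]bin_small ?muln0 // ltn_subLR.
  by rewrite bin_small.
have leb : (b <= a)%N by apply: leq_trans le; rewrite leq_addr.
apply/eqP; rewrite -(eqn_pmul2r (_ : 0 < b`! * c`! * (a - (b + c))`!)%N);
  last by rewrite !muln_gt0 !fact_gt0.
apply/eqP; transitivity a`!.
  rewrite -(bin_fact leb) -(@bin_fact (a - b) c) ?leq_subRL //.
  by rewrite subnDA; lia.
rewrite -(bin_fact le) -(@bin_fact (b + c) b) ?leq_addr // addKn.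
lia.
Qed.

(** The Taylor formula for a Hasse derivative of the monomial X^a; terms with
    index beyond [a - b] vanish, so any bound [B > a] may be used. *)
Lemma hasse_expr_taylor (R : comNzRingType) (x y : R) (B a b : nat) :
    (a < B)%N ->
  (x + y) ^+ (a - b) *+ 'C(a, b) =
  \sum_(g < B) (y ^+ g *+ 'C(b + g, b)) * (x ^+ (a - (b + g)) *+ 'C(a, b + g)).
Proof.
move=> ltaB; have ltB : ((a - b).+1 <= B)%N.
  by apply: leq_ltn_trans ltaB; rewrite leq_subr.
rewrite exprDn -sumrMnl.
rewrite (big_ord_widen_cond _ (fun=> true)
  (fun i => x ^+ (a - b - i) * y ^+ i *+ 'C(a - b, i) *+ 'C(a, b)) ltB).
rewrite big_mkcond; apply: eq_bigr => g _ /=.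
rewrite mulrnAl mulrnAr -!mulrnA [(_ * 'C(a, b))%N]mulnC bin_trinomial.
rewrite [y ^+ _ * _]mulrC subnDA.
case: ifP => // /negbT; rewrite -leqNgt => lt.
by rewrite -bin_trinomial (bin_small lt) !muln0 !mulr0n.
Qed.

Section Hasse.
Variables (I : finType) (N : nat) (e : I -> 'I_N -> nat).

(** A polynomial in N variables is given by a finite index type [I], the
    exponents [e al] of the monomial of index [al], and the coefficients [p].
    [hasse p x b] is the value at [x] of its Hasse derivative of multi-index
    [b], that is, the coefficient of y^b in p(x + y). Truncation in
    [e a i - b i] is harmless, as the binomial coefficient is then 0. *)
Definition hasse (R : comNzRingType) (p : I -> R) (x : 'I_N -> R)
    (b : 'I_N -> nat) : R :=
  \sum_(a : I) p a * \prod_i (x i ^+ (e a i - b i) *+ 'C(e a i, b i)).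

Lemma hasseB (R : comNzRingType) (p p' : I -> R) x b :
  hasse (fun al => p al - p' al) x b = hasse p x b - hasse p' x b.
Proof. by rewrite -sumrB; apply: eq_bigr => al _; rewrite mulrBl. Qed.

Lemma eq_hasse (R : comNzRingType) (p p' : I -> R) x x' b b' :
  p =1 p' -> x =1 x' -> b =1 b' -> hasse p x b = hasse p' x' b'.
Proof.
move=> Ep Ex Eb; apply: eq_bigr => a _; rewrite Ep; congr (_ * _).
by apply: eq_bigr => i _; rewrite Ex Eb.
Qed.

Lemma hasse_morph (R R' : comNzRingType) (f : {rmorphism R -> R'}) p x b :
  f (hasse p x b) = hasse (f \o p) (f \o x) b.
Proof.
rewrite rmorph_sum; apply: eq_bigr => a _; rewrite rmorphM rmorph_prod.
by congr (_ * _); apply: eq_bigr => i _; rewrite rmorphMn rmorphXn.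
Qed.

Lemma hasse_taylor (R : comNzRingType) (B : nat) (p : I -> R) x y b :
    (forall a i, (e a i < B)%N) ->
  hasse p (fun i => x i + y i) b =
  \sum_(g : {ffun 'I_N -> 'I_B})
    (\prod_i (y i ^+ g i *+ 'C(b i + g i, b i))) *
    hasse p x (fun i => b i + g i)%N.
Proof.
move=> ltB; under [RHS]eq_bigr do rewrite mulr_sumr.
rewrite exchange_big; apply: eq_bigr => a _ /=.
under eq_bigr do rewrite (hasse_expr_taylor _ _ _ (ltB _ _)).
rewrite bigA_distr_bigA mulr_sumr; apply: eq_bigr => g _.
by rewrite big_split /= mulrCA.
Qed.
End Hasse.

(** * Multiple roots and leading coefficients of univariate polynomials *)

Lemma dvdp_XsubC_comp (K : fieldType) (f : {poly K}) (c : K) (n : nat) :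
  'X^n %| f \Po ('X + c%:P) -> ('X - c%:P) ^+ n %| f.
Proof.
case/dvdpP => g /(congr1 (fun h => h \Po ('X - c%:P))).
rewrite -comp_polyA comp_polyD comp_polyC comp_polyX subrK comp_polyXr => ->.
by rewrite rmorphM /= comp_Xn_poly dvdp_mull.
Qed.

Lemma nderivn_dvdp_XsubC (K : fieldType) (f : {poly K}) (c : K) (n : nat) :
    (forall j, (j < n)%N -> f^`N(j).[c] = 0) -> ('X - c%:P) ^+ n %| f.
Proof.
move=> f0; apply: dvdp_XsubC_comp.
rewrite /comp_poly addrC nderiv_taylor; last exact: mulrC.
apply: (big_ind (fun u => _ %| u)) => [|u v|i _]; rewrite ?dvdp0 //.
  exact: dvdp_add.
rewrite nderivn_map horner_map /=.
have [lt|ge] := ltnP i n; first by rewrite f0 ?mul0r ?dvdp0.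
by rewrite dvdp_mull ?dvdp_exp2l.
Qed.

Lemma dvdp_prod_XsubC_exp (K : fieldType) (f : {poly K}) (s : seq K) (n : nat) :
    uniq s -> (forall c, c \in s -> ('X - c%:P) ^+ n %| f) ->
  \prod_(c <- s) ('X - c%:P) ^+ n %| f.
Proof.
elim: s => [|c s IH] /=; first by rewrite big_nil dvd1p.
case/andP=> cs us H; rewrite big_cons Gauss_dvdp.
  by rewrite H ?mem_head //= IH // => d ds; apply: H; rewrite inE ds orbT.
apply: coprimep_expl; rewrite big_seq; elim/big_rec: _ => [|d g ds cg].
  exact: coprimep1.
rewrite coprimepMr cg andbT coprimep_expr // coprimep_XsubC2 // subr_eq0.
by apply: contraNneq cs => <-.
Qed.

Lemma poly_many_roots0 (K : fieldType) (f : {poly K}) (s : seq K) (n : nat) :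
    uniq s -> (forall c, c \in s -> ('X - c%:P) ^+ n %| f) ->
  (size f <= n * size s)%N -> f = 0.
Proof.
move=> us H; apply: contraTeq => f0; rewrite -ltnNge.
apply: leq_trans (dvdp_leq f0 (dvdp_prod_XsubC_exp us H)).
rewrite prodrXl; have := size_exp (\prod_(c <- s) ('X - c%:P)) n.
rewrite size_prod_XsubC /= mulnC => <-; rewrite ltn_predL size_poly_gt0.
by rewrite expf_neq0 // monic_neq0 // monic_prod_XsubC.
Qed.

Section TopCoef.
Variable R : comNzRingType.

(** [f] has degree at most [n], and its coefficient of degree [n] (possibly 0)
    is [c]. *)
Definition top_coef (n : nat) (c : R) (f : {poly R}) : Prop :=
  (size f <= n.+1)%N /\ f`_n = c.

Lemma top_coefM n m c d f g :
  top_coef n c f -> top_coef m d g -> top_coef (n + m) (c * d) (f * g).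
Proof.
move=> [sf <-] [sg <-]; split.
  apply: leq_trans (size_polyMleq _ _) _; lia.
rewrite coefM; have ltn : (n < (n + m).+1)%N by lia.
rewrite (bigD1 (Ordinal ltn)) //= addKn big1 ?addr0 // => i /eqP/val_eqP /= ne.
have [lt|ge] := ltnP i n.
  by rewrite [g`__]nth_default ?mulr0 //; apply: leq_trans sg _; lia.
by rewrite [f`__]nth_default ?mul0r //; apply: leq_trans sf _; lia.
Qed.

Lemma top_coefX n c f k : top_coef n c f -> top_coef (n * k) (c ^+ k) (f ^+ k).
Proof.
move=> H; elim: k => [|k IH].
  by rewrite muln0 !expr0; split; rewrite ?size_poly1 // coef1.
by rewrite mulnS !exprS; apply: top_coefM.
Qed.

Lemma top_coefMn n c f k : top_coef n c f -> top_coef n (c *+ k) (f *+ k).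
Proof.
move=> [sf <-]; split; last by rewrite coefMn.
apply/leq_sizeP => j ltj; rewrite coefMn nth_default ?mul0rn //.
exact: leq_trans sf ltj.
Qed.

Lemma top_coef_sum (I : finType) n (c : I -> R) (f : I -> {poly R}) :
  (forall i, top_coef n (c i) (f i)) -> top_coef n (\sum_i c i) (\sum_i f i).
Proof.
move=> H; apply: (big_rec2 (top_coef n)).
  by rewrite /top_coef size_poly0 coef0.
move=> i c' f' _ [s' <-]; have [s <-] := H i; split; last by rewrite coefD.
by apply: leq_trans (size_polyD _ _) _; rewrite geq_max s.
Qed.

Lemma top_coef_small n (f : {poly R}) : (size f <= n)%N -> top_coef n 0 f.
Proof. by move=> s; split; [exact: leqW | rewrite nth_default]. Qed.

Lemma top_coef_line (a b : R) n :
  top_coef n (b ^+ n) ((a%:P + b%:P * 'X) ^+ n).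
Proof.
rewrite -{1}[n]mul1n; apply: top_coefX; split.
  rewrite addrC size_MXaddC; case: ifP => // _.
  by rewrite ltnS; exact: size_polyC_leq1.
by rewrite addrC coefD coefMX coefC /= coefC addr0.
Qed.
End TopCoef.

(** * Restriction to a line *)

Section Lines.
Variables (I : finType) (N : nat) (e : I -> 'I_N -> nat) (K : fieldType).

(** The homogeneous part of degree [d] of [p]. *)
Definition top_part (d : nat) (p : I -> K) (al : I) : K :=
  if (\sum_i e al i == d)%N then p al else 0.

(** The Hasse derivative of multi-index [be] of [p], restricted to the line
    a + X b: a univariate polynomial. *)
Definition on_line (p : I -> K) (a b : 'I_N -> K) be : {poly K} :=
  hasse e (fun al => (p al)%:P) (fun i => (a i)%:P + (b i)%:P * 'X) be.

(** The restriction of a Hasse derivative to the line a + X b has as top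
    coefficient the same Hasse derivative of the top part of [p], taken at
    the point at infinity [b] of the line. *)
Lemma top_coef_on_line p a b be d :
    (forall al, p al != 0 -> (\sum_i e al i <= d)%N) ->
  top_coef (d - \sum_i be i) (hasse e (top_part d p) b be) (on_line p a b be).
Proof.
move=> supp; apply: top_coef_sum => al.
have [p0|/supp le_d] := eqVneq (p al) 0.
  rewrite /top_part p0 if_same !mul0r; apply: top_coef_small.
  by rewrite size_poly0.
have [/forallP le_be|] := boolP [forall i, be i <= e al i]%N; last first.
  rewrite negb_forall => /existsP [i]; rewrite -ltnNge => lt.
  have prod0 (R : comNzRingType) (x : 'I_N -> R) :
      \prod_j (x j ^+ (e al j - be j) *+ 'C(e al j, be j)) = 0.
    by rewrite (bigD1 i) //= bin_small // mulr0n mul0r.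
  rewrite !prod0 !mulr0.
  by apply: top_coef_small; rewrite size_poly0.
have top : top_coef (\sum_i (e al i - be i))
    (\prod_i (b i ^+ (e al i - be i) *+ 'C(e al i, be i)))
    (\prod_i (((a i)%:P + (b i)%:P * 'X) ^+ (e al i - be i)
       *+ 'C(e al i, be i))).
  apply: (big_rec3 (fun n c f => top_coef n c f)).
    by split; rewrite ?size_poly1 // coef1.
  move=> i n c f _ IH; apply: top_coefM IH.
  by apply: top_coefMn; apply: top_coef_line.
have Es : (\sum_i (e al i - be i) = \sum_i e al i - \sum_i be i)%N.
  by rewrite sumnB // => i _; apply: le_be.
rewrite {}Es in top.
have top' : top_coef (\sum_i e al i - \sum_i be i)
    (p al * \prod_i (b i ^+ (e al i - be i) *+ 'C(e al i, be i)))
    ((p al)%:P * \prod_i (((a i)%:P + (b i)%:P * 'X) ^+ (e al i - be i)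
       *+ 'C(e al i, be i))).
  rewrite -[(_ - _)%N]add0n; apply: top_coefM top.
  by split; rewrite ?coefC ?size_polyC_leq1.
rewrite /top_part; case: eqP => [<- //|ne]; rewrite mul0r.
apply: top_coef_small.
have le_sum : (\sum_i be i <= \sum_i e al i)%N by apply: leq_sum => i _.
have [s _] := top'; apply: leq_trans s _; move: le_d ne le_sum; lia.
Qed.

(** If [p] vanishes to order [M] at the point a + t b, then its Hasse
    derivatives of order w restricted to the line a + X b vanish to order
    [M - w] at [t]. *)
Lemma on_line_dvdp p a b be M t :
    (forall ga, (\sum_i ga i < M)%N ->
       hasse e p (fun i => a i + t * b i) ga = 0) ->
  ('X - t%:P) ^+ (M - \sum_i be i) %| on_line p a b be.
Proof.
move=> van; apply: dvdp_XsubC_comp.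
rewrite /on_line (hasse_morph _ (comp_poly ('X + t%:P))) /=.
pose B := (\max_al \max_i e al i).+1.
have ltB al i : (e al i < B)%N.
  by rewrite ltnS (leq_trans _ (leq_bigmax al)) // (leq_bigmax i).
rewrite (@eq_hasse _ _ _ _ _ (fun al => (p al)%:P) _
  (fun i => (a i + t * b i)%:P + (b i)%:P * 'X) _ be); first last.
- by [].
- move=> i /=; rewrite comp_polyD comp_polyM comp_polyX !comp_polyC.
  by rewrite polyCD polyCM mulrDr addrA addrAC [_ * t%:P]mulrC.
- by move=> al /=; rewrite comp_polyC.
rewrite (hasse_taylor _ _ _ _ ltB).
apply: (big_ind (fun u => _ %| u)) => [|u v|g _]; rewrite ?dvdp0 //.
  exact: dvdp_add.
(* In the term y^g of the Taylor expansion with y = X b, either the derivative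
   of order be + g vanishes at a + t b, or X^|g| gives the divisibility. *)
have [lt|ge] := ltnP (\sum_i (be i + g i)) M.
  by rewrite -(hasse_morph _ polyC) van // rmorph0 mulr0 dvdp0.
apply: dvdp_mulr; rewrite (eq_bigr (fun i =>
    (b i)%:P ^+ g i *+ 'C(be i + g i, be i) * 'X ^+ g i)); last first.
  by move=> i _; rewrite exprMn mulrnAl.
rewrite big_split /= prodrXr dvdp_mull // dvdp_exp2l // leq_subLR.
by rewrite -big_split.
Qed.

Lemma hasse_top_eq0 p a b be d M (s : seq K) :
    (forall al, p al != 0 -> (\sum_i e al i <= d)%N) -> uniq s ->
    (forall t, t \in s -> forall ga, (\sum_i ga i < M)%N ->
       hasse e p (fun i => a i + t * b i) ga = 0) ->
    (d - \sum_i be i < (M - \sum_i be i) * size s)%N ->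
  hasse e (top_part d p) b be = 0.
Proof.
move=> supp us van lt; have [sz <-] := top_coef_on_line a b be supp.
rewrite (@poly_many_roots0 _ (on_line p a b be) s (M - \sum_i be i) us) ?coef0 //.
  by move=> t ts; apply: on_line_dvdp; apply: van.
exact: leq_trans sz lt.
Qed.
End Lines.

(** * Polynomials vanishing to high order everywhere *)

(** A linear form on univariate polynomials that kills X^a' for a' < a, maps
    X^a to 1, and is a combination of the values at the points of K of the
    Hasse derivatives of order at most a %/ #|K|. It exists because a
    polynomial of degree at most a with all these values zero is zero. The
    orders range over the common type ['I_B] so that such forms for different
    [a] can be multiplied. *)
Lemma hermite_dual (K : finFieldType) (B a : nat) : (a < B)%N ->
  exists la : K * 'I_B -> K,
    (forall u, la u != 0 -> (u.2 <= a %/ #|K|)%N) /\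
    (forall a', (a' <= a)%N ->
      \sum_u la u * (u.1 ^+ (a' - u.2) *+ 'C(a', u.2)) = (a' == a)%:R).
Proof.
move=> ltaB; set q := #|K|; have q_gt0 : (0 < q)%N by apply/card_gt0P; exists 0.
pose T := (K * 'I_B)%type.
pose A := \matrix_(i < a.+1, j < #|{: T}|)
  let u := enum_val j in
  (u.2 <= a %/ q)%N%:R * (u.1 ^+ (i - u.2) *+ 'C(i, u.2)) : K.
have /row_freeP [X AX] : row_free A.
  apply: inj_row_free => v vA0; apply: (can_inj rVpolyK); rewrite linear0.
  apply: (@poly_many_roots0 _ _ (enum K) (a %/ q).+1 (enum_uniq K)); last first.
    by rewrite -cardE; apply: leq_trans (size_poly _ _) _; exact: ltn_ceil.
  move=> c _; apply: nderivn_dvdp_XsubC => j; rewrite ltnS => lej.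
  have ltj : (j < B)%N.
    by apply: leq_ltn_trans ltaB; apply: leq_trans (leq_div a q).
  have := congr1 (fun w : 'rV_ _ => w 0 (enum_rank ((c, Ordinal ltj) : T))) vA0.
  rewrite !mxE => vA; rewrite -[RHS]vA.
  have -> : rVpoly v = \sum_(i < a.+1) v 0 i *: 'X^i.
    by rewrite /rVpoly poly_def; apply: eq_bigr => i _; rewrite valK.
  rewrite linear_sum horner_sum; apply: eq_bigr => i _ /=.
  rewrite linearZ /= nderivnXn hornerZ hornerMn hornerXn mxE enum_rankK /=.
  by rewrite lej mul1r.
exists (fun u : T => (u.2 <= a %/ q)%N%:R * X (enum_rank u) ord_max); split.
  by move=> u; case: leqP => // _; rewrite mul0r eqxx.
move=> a'; rewrite -ltnS => lta'.
have := congr1 (fun W : 'M_ _ => W (Ordinal lta') ord_max) AX.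
rewrite !mxE -val_eqE /= => <-; rewrite (reindex (@enum_val {: T} {: T})); last first.
  by apply: onW_bij; apply: enum_val_bij.
by apply: eq_bigr => j _; rewrite mxE enum_valK /= mulrAC.
Qed.

Section Grid.
Variables (I : finType) (N : nat) (e : I -> 'I_N -> nat).
Hypothesis e_inj : forall al al', e al =1 e al' -> al = al'.

(** Distinct exponents of equal total degree are incomparable. *)
Lemma exponent_lt al al' : (\sum_i e al' i = \sum_i e al i)%N -> al' != al ->
  exists i, (e al' i < e al i)%N.
Proof.
move=> Es ne; apply/existsP; apply: contraR ne.
rewrite negb_exists => /forallP le; apply/eqP/e_inj => i.
have lei j : (e al j <= e al' j ?= iff (e al j == e al' j))%N.
  by split=> //; rewrite leqNgt le.
have [_] := leqif_sum (fun j (_ : true) => lei j).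
by rewrite Es eqxx => /esym/forallP/(_ i)/eqP.
Qed.

(** The Hasse derivatives of order [d] of a homogeneous polynomial of degree
    [d] are constants, equal to its coefficients. *)
Lemma hasse_homog (R : comNzRingType) (p : I -> R) x al d :
    (forall al', p al' != 0 -> (\sum_i e al' i = d)%N) ->
    (\sum_i e al i = d)%N ->
  hasse e p x (e al) = p al.
Proof.
move=> supp dal; rewrite /hasse (bigD1 al) //= [X in _ * X]big1 ?mulr1; last first.
  by move=> i _; rewrite subnn binn.
rewrite big1 ?addr0 // => al' ne; have [->|/supp dal'] := eqVneq (p al') 0.
  by rewrite mul0r.
have [|i lt] := @exponent_lt al al' _ ne; first by rewrite dal dal'.
by rewrite (bigD1 i) //= bin_small // mulr0n mul0r mulr0.
Qed.

Lemma hasse_at0 (R : comNzRingType) (p : I -> R) x be :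
    (forall i, x i = 0) ->
    (forall al, p al != 0 -> (\sum_i e al i != \sum_i be i)%N) ->
  hasse e p x be = 0.
Proof.
move=> x0 supp; rewrite /hasse big1 // => al _.
have [->|/supp ne] := eqVneq (p al) 0; first by rewrite mul0r.
have [i nei] : exists i, e al i != be i.
  apply/existsP; apply: contraR ne; rewrite negb_exists => /forallP E.
  by apply/eqP; apply: eq_bigr => i _; apply/eqP; rewrite -[_ == _]negbK.
rewrite (bigD1 i) //= x0; case: ltngtP nei => // lt _.
  by rewrite bin_small // mulr0n mul0r mulr0.
by rewrite expr0n subn_eq0 leqNgt lt mul0rn mul0r mulr0.
Qed.

(** A homogeneous polynomial of degree less than l * #|K| that vanishes to
    order [l] at every point of K^N is zero. *)
Lemma grid_hasse_eq0 (K : finFieldType) (p : I -> K) d l :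
    (forall al, p al != 0 -> (\sum_i e al i = d)%N) -> (d < l * #|K|)%N ->
    (forall x be, (\sum_i be i < l)%N -> hasse e p x be = 0) ->
  forall al, p al = 0.
Proof.
move=> supp ltd van al; have [//|p_al] := eqVneq (p al) 0.
have dal := supp _ p_al.
pose B := (\max_i e al i).+1.
have ltB i : (e al i < B)%N by rewrite ltnS (leq_bigmax i).
have [la Hla] := fin_all_exists (fun i => @hermite_dual K B _ (ltB i)).
(* Apply to p the tensor product of the forms la i, which extracts the
   coefficient of index al. *)
transitivity (\sum_(g : {ffun 'I_N -> K * 'I_B}) (\prod_i la i (g i)) *
    hasse e p (fun i => (g i).1) (fun i => (g i).2 : nat)); last first.
  rewrite big1 // => g _.
  have [/existsP [i /eqP la0]|] := boolP [exists i, la i (g i) == 0].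
    by rewrite (bigD1 i) //= la0 !mul0r.
  rewrite negb_exists => /forallP la0; rewrite van ?mulr0 //.
  have q_gt0 : (0 < #|K|)%N by apply/card_gt0P; exists 0.
  rewrite -(ltn_pmul2r q_gt0); apply: leq_ltn_trans ltd.
  rewrite -dal big_distrl /=; apply: leq_sum => i _.
  by rewrite -leq_divRL //; apply: (Hla i).1.
rewrite /hasse; under eq_bigr do rewrite mulr_sumr.
rewrite exchange_big /= (bigD1 al) //= [X in _ = _ + X]big1 ?addr0.
  under eq_bigr do rewrite mulrCA -big_split /=.
  rewrite -mulr_sumr -(bigA_distr_bigA (fun i (u : K * 'I_B) => la i u *
    (u.1 ^+ (e al i - u.2) *+ 'C(e al i, u.2)))).
  rewrite big1 ?mulr1 // => i _.
  by rewrite (Hla i).2 // eqxx.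
move=> al' ne; under eq_bigr do rewrite mulrCA -big_split /=.
rewrite -mulr_sumr -(bigA_distr_bigA (fun i (u : K * 'I_B) => la i u *
  (u.1 ^+ (e al' i - u.2) *+ 'C(e al' i, u.2)))).
have [->|/supp dal'] := eqVneq (p al') 0; first by rewrite mul0r.
have [|i lt] := @exponent_lt al al' _ ne; first by rewrite dal dal'.
rewrite (bigD1 i) //= (Hla i).2 ?(ltnW lt) //.
by rewrite (ltn_eqF lt) mul0r mulr0.
Qed.
End Grid.

(** * Sets meeting a line in every direction *)

(** Every direction [b] has a line a + K b that meets [S] in at least [m]
    points; K^N is the type of functions from ['I_N] to [K]. *)
Definition line_furstenberg (K : finFieldType) (N m : nat)
    (S : {set {ffun 'I_N -> K}}) :=
  forall b : {ffun 'I_N -> K}, b != 0 -> exists a : {ffun 'I_N -> K},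
    (m <= #|[set t : K | [ffun i => a i + t * b i]%R \in S]|)%N.

Section LineSets.
Variables (I : finType) (N : nat) (e : I -> 'I_N -> nat).
Hypothesis e_inj : forall al al', e al =1 e al' -> al = al'.

(** The core of the method of multiplicities: under numerical conditions on
    the orders [l] and [M], a polynomial of degree less than l * #|K| that
    vanishes to order [M] on [S] is zero. The degree is lowered one step at a
    time, by showing that the top homogeneous part is zero. *)
Lemma line_furstenberg_interp (K : finFieldType) m (S : {set {ffun 'I_N -> K}})
    (p : I -> K) (l M : nat) :
    (0 < N)%N -> line_furstenberg m S ->
    (forall d w, (d < l * #|K|)%N -> (w < l)%N -> (d - w < (M - w) * m)%N) ->
    (forall al, p al != 0 -> (\sum_i e al i < l * #|K|)%N) ->
    (forall s be, s \in S -> (\sum_i be i < M)%N -> hasse e p s be = 0) ->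
  forall al, p al = 0.
Proof.
move=> N_gt0 SF ineq supp van.
have van_top d x be : (forall al, p al != 0 -> (\sum_i e al i <= d)%N) ->
    (d < l * #|K|)%N -> (exists i, x i != 0) -> (\sum_i be i < l)%N ->
    hasse e (top_part e d p) x be = 0.
  move=> le_d ltd [i0 xi0] ltl.
  have [|a Ha] := SF [ffun i => x i].
    by apply: contra_neq xi0 => /ffunP/(_ i0); rewrite !ffunE.
  apply: (@hasse_top_eq0 _ _ _ _ p a x be d M (enum [set t : K |
    [ffun i => a i + t * [ffun i => x i] i] \in S])) => //.
  - exact: enum_uniq.
  - move=> t; rewrite mem_enum inE => tS ga ltM.
    rewrite -[RHS](van _ ga tS ltM); apply: eq_hasse => // i.
    by rewrite !ffunE.
  apply: leq_trans (ineq _ _ ltd ltl) _.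
  by rewrite -cardE leq_mul2l Ha orbT.
suff H D : (D <= l * #|K|)%N ->
    (forall al, p al != 0 -> (\sum_i e al i < D)%N) ->
    forall al, p al = 0 by exact: H supp.
elim: D => [|d IH] leD suppD al.
  by apply/eqP; apply: contraT => /suppD.
apply: IH; first exact: ltnW.
move=> {}al p_al; have := suppD _ p_al.
rewrite ltnS leq_eqVlt => /orP [/eqP dal|//].
have top_supp al' : top_part e d p al' != 0 -> (\sum_i e al' i = d)%N.
  by rewrite /top_part; case: ifP => [/eqP -> //|_]; rewrite eqxx.
case/negP: p_al; apply/eqP.
have <- : top_part e d p al = p al by rewrite /top_part dal eqxx.
(* Vanishing at the origin is not covered by lines: for l <= d it holds by
   homogeneity, and for d < l the derivatives of order d, which are constant,
   already show that the top part is zero. *)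
have [lt_dl|le_ld] := ltnP d l.
  rewrite -(hasse_homog e_inj (fun=> 1) top_supp dal) van_top ?dal //.
  by exists (Ordinal N_gt0); rewrite oner_eq0.
apply: (grid_hasse_eq0 e_inj top_supp leD) => x be ltl.
have [/existsP x_neq0|] := boolP [exists i, x i != 0]; first exact: van_top.
rewrite negb_exists => /forallP x0; apply: hasse_at0.
  by move=> i; apply/eqP; rewrite -[_ == _]negbK.
move=> al' /top_supp ->; by rewrite gtn_eqF // (leq_trans ltl).
Qed.
End LineSets.

(** * Counting coefficients and conditions *)

Lemma expn_le_ffact n N : (n.+1 ^ N <= (N + n) ^_ N)%N.
Proof.
elim: N => [|N IH]; first by rewrite ffactn0.
by rewrite addSn ffactSS expnS leq_mul // ltnS leq_addl.
Qed.

Lemma ffact_le_expn n N : (n ^_ N <= n ^ N)%N.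
Proof.
elim: N n => [|N IH] n; first by rewrite ffactn0.
rewrite ffactnS expnS leq_mul2l; apply/orP; right.
apply: leq_trans (IH _) _; case: N {IH} => // N; rewrite leq_exp2r //; lia.
Qed.

(** The exponents of the monomials of degree at most [D] in [N] variables. *)
Definition exponents (N D : nat) : predArgType :=
  {t : N.-tuple 'I_D.+1 |
     t \in [set t : N.-tuple 'I_D.+1 | (\sum_(i <- t) i <= D)%N]}.

HB.instance Definition _ N D := Finite.on (exponents N D).

Lemma card_exponents N D : #|{: exponents N D}| = 'C(N + D, N).
Proof. by rewrite card_sig -card_partial_ord_partitions; apply: eq_card. Qed.

Definition expo N D (t : exponents N D) (i : 'I_N) : nat := tnth (val t) i.

Lemma sum_expo N D (t : exponents N D) : (\sum_i expo t i <= D)%N.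
Proof. by have := valP t; rewrite inE big_tuple. Qed.

Lemma expo_inj N D (t t' : exponents N D) : expo t =1 expo t' -> t = t'.
Proof. by move=> E; apply/val_inj/eq_from_tnth => i; apply/val_inj/E. Qed.

Lemma expo_surj N D (f : 'I_N -> nat) : (\sum_i f i <= D)%N ->
  exists t : exponents N D, expo t =1 f.
Proof.
move=> leD; have ltf i : (f i < D.+1)%N.
  by rewrite ltnS (leq_trans _ leD) // (bigD1 i) //= leq_addr.
pose t := [tuple Ordinal (ltf i) | i < N].
have Ht : t \in [set t : N.-tuple 'I_D.+1 | (\sum_(i <- t) i <= D)%N].
  rewrite inE big_tuple; apply: leq_trans leD; apply: leq_sum => i _.
  by rewrite tnth_mktuple.
by exists (exist _ t Ht) => i; rewrite /expo /= tnth_mktuple.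
Qed.

(** By [line_furstenberg_interp], a polynomial of degree at most [D] is
    determined by its Hasse derivatives of order at most [M] on [S], so there
    are at most as many coefficients as there are values. *)
Lemma line_furstenberg_count (K : finFieldType) (N m D M l : nat)
    (S : {set {ffun 'I_N -> K}}) :
    (0 < N)%N -> line_furstenberg m S -> D.+1 = (l * #|K|)%N ->
    (forall d w, (d < l * #|K|)%N -> (w < l)%N -> (d - w < (M.+1 - w) * m)%N) ->
  ('C(N + D, N) <= 'C(N + M, N) * #|S|)%N.
Proof.
move=> N_gt0 SF ED ineq.
pose g (p : {ffun exponents N D -> K}) :
    {ffun exponents N M * {s | s \in S} -> K} :=
    [ffun u : exponents N M * {s | s \in S} =>
       hasse (@expo N D) p (val u.2) (expo u.1)].
have g_inj : injective g.
  move=> p p' gE; apply/ffunP => al; apply/eqP; rewrite -subr_eq0; apply/eqP.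
  apply: (line_furstenberg_interp (@expo_inj N D)
    (p := fun al => p al - p' al) N_gt0 SF ineq).
    by move=> al' _; rewrite -ED ltnS sum_expo.
  move=> s be sS; rewrite ltnS => /expo_surj [t tE].
  have := congr1 (fun h : {ffun _ -> K} => h (t, exist _ s sS)) gE.
  rewrite !ffunE /=.
  rewrite !(eq_hasse _ (frefl _) (frefl _) tE) hasseB => ->; exact: subrr.
have := leq_card g g_inj; rewrite !card_ffun card_prod !card_exponents card_sig.
by rewrite leq_exp2l ?finNzRing_gt1.
Qed.

Lemma line_furstenberg_bound (K : finFieldType) (N m : nat)
    (S : {set {ffun 'I_N -> K}}) :
    (0 < N)%N -> (0 < m)%N -> (m <= #|K|)%N -> line_furstenberg m S ->
  (m ^ N <= 2 ^ N * #|S|)%N.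
Proof.
move=> N_gt0 m_gt0 le_m SF; set q := #|K| in le_m *.
have q_gt0 : (0 < q)%N := leq_trans m_gt0 le_m.
(* For l = m * N, the order M.+1 of vanishing is the smallest one for which
   ineq holds, and the factor N in l gives N + M <= 2 * (N * q). The
   predecessors turn strict bounds on degrees into large ones. *)
pose l := (m * N)%N; pose M := (N * (q.-1 + m)).-1; pose D := (l * q).-1.
have EM : M.+1 = (N * (q.-1 + m))%N.
  by rewrite prednK // muln_gt0 N_gt0 addn_gt0 m_gt0 orbT.
have ED : D.+1 = (l * q)%N by rewrite prednK // !muln_gt0 m_gt0 N_gt0.
have ineq d w : (d < l * q)%N -> (w < l)%N -> (d - w < (M.+1 - w) * m)%N.
  rewrite EM /l => ltd ltw.
  have -> : (N * (q.-1 + m) - w = N * q.-1 + (m * N - w))%N.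
    by rewrite mulnDr [(N * m)%N]mulnC addnBA // ltnW.
  have le_u : (m * N - w <= (m * N - w) * m)%N by rewrite leq_pmulr.
  have eq_q : (m * N * q = N * q.-1 * m + m * N)%N.
    rewrite -{1}(prednK q_gt0) mulnS addnC.
    by rewrite [(N * _ * _)%N]mulnAC [(N * m)%N]mulnC.
  move: ltd ltw le_u; rewrite mulnDl eq_q.
  move: (N * q.-1 * m)%N (m * N)%N => A B; move: ((B - w) * m)%N => C; lia.
have := line_furstenberg_count N_gt0 SF ED ineq.
rewrite -(leq_pmul2r (fact_gt0 N)) mulnAC !bin_ffact => le.
have {}le : ((m * (N * q)) ^ N <= (2 * (N * q)) ^ N * #|S|)%N.
  apply: leq_trans (leq_trans le _).
    by apply: leq_trans (expn_le_ffact _ _); rewrite ED /l mulnA.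
  rewrite leq_mul2r; apply/orP; right; apply: leq_trans (ffact_le_expn _ _) _.
  rewrite leq_exp2r //; nia.
rewrite -(leq_pmul2r (_ : 0 < (N * q) ^ N)%N); last first.
  by rewrite expn_gt0 muln_gt0 N_gt0 q_gt0.
by rewrite mulnAC -!expnMn.
Qed.

(** * Reduction to lines over an extension field *)

(** Inside a splitting field of X^(q^k) - X over F, with q = #|F|, the roots
    are the fixed field of the k-th power of the Frobenius automorphism; they
    are simple, so this field has q^k elements and dimension k. *)
Lemma exists_fieldExt_dim (F : finFieldType) (k : nat) : (0 < k)%N ->
  exists L : fieldExtType F, \dim {:L} = k.
Proof.
move=> k_gt0; set q := #|F|; pose Q := (q ^ k)%N.
have q_gt1 : (1 < q)%N := finNzRing_gt1 F.
have Q_gt1 : (1 < Q)%N by rewrite /Q -{1}(expn0 q) ltn_exp2l.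
pose P (R : nzRingType) : {poly R} := 'X^Q - 'X.
have szP (R : nzRingType) : size (P R) = Q.+1.
  by rewrite size_polyDl size_polyXn // size_polyN size_polyX.
have nzP : P F != 0 by rewrite -size_poly_eq0 szP.
have [L [zs]] := FinSplittingFieldFor nzP.
rewrite rmorphB rmorphXn /= map_polyX -/(P L) => eqP_zs _.
have Q0 : Q%:R = 0 :> L.
  have [p pr_p pF] := finPcharP F.
  have pL : p \in [pchar L] by rewrite pchar_lalg.
  apply/eqP; rewrite -(dvdn_pcharf pL) /Q /q (card_pprimeChar pF).
  have : (1 < p ^ logn p #|F|)%N by rewrite -(card_pprimeChar pF).
  case: (logn _ _) => // n _.
  by rewrite -expnM mulSn -(prednK k_gt0) addSn expnS dvdn_mulr.
have Uzs : uniq zs.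
  rewrite -separable_prod_XsubC -(eqp_separable eqP_zs) unlock.
  rewrite derivB derivX derivXn -mulr_natr -(rmorph_nat (@polyC L)) Q0.
  rewrite rmorph0 mulr0 sub0r -scaleN1r coprimepZr ?coprimep1 //.
  by rewrite oppr_eq0 oner_eq0.
have sz_zs : size zs = Q.
  by apply: succn_inj; rewrite -(size_prod_XsubC zs id) -(eqp_size eqP_zs) szP.
have [al _ al_pow] := finField_galois_generator (sub1v {:L}).
pose E := [aspace of fixedField [set (al ^+ k)%g]].
have inE : zs =i E.
  move=> z; rewrite -root_prod_XsubC -(eqp_root eqP_zs) /root !hornerE subr_eq0.
  have pow n : (al ^+ n)%g z = z ^+ (q ^ n).
    elim: n => [|n IH]; first by rewrite expg0 gal_id expn0 expr1.
    rewrite expgSr galM ?memvf // IH al_pow ?memvf // dimv1 expn1.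
    by rewrite -exprM -expnSr.
  apply/eqP/fixedFieldP; rewrite ?memvf //.
    by move=> zQ _ /set1P ->; rewrite pow.
  by move=> /(_ _ (set11 _)); rewrite pow.
exists (subvs_of E); rewrite dimvf /dim /=.
apply/eqP; rewrite -(eqn_exp2l _ _ q_gt1) -/Q -sz_zs; apply/eqP.
rewrite -(card_uniqP (T := finvect_type L) Uzs).
rewrite -(@card_vspace F (finvect_type L)).
by apply: eq_card => x; rewrite inE.
Qed.

Section FieldReduction.
Import VectorInternalTheory.
Variables (F : finFieldType) (L : fieldExtType F) (N : nat).
Let K := finvect_type L.

(** The isomorphism from L^N to F^(N * dim L) that concatenates the coordinates
    of the components, and its inverse. *)
Definition flatten_ext (u : {ffun 'I_N -> K}) : 'rV[F]_(N * dim L) :=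
  mxvec (\matrix_i v2r (u i : L)).

Definition unflatten_ext (x : 'rV[F]_(N * dim L)) : {ffun 'I_N -> K} :=
  [ffun i => r2v (row i (vec_mx x)) : L].

Lemma flatten_extK : cancel flatten_ext unflatten_ext.
Proof. by move=> u; apply/ffunP => i; rewrite ffunE mxvecK rowK v2rK. Qed.

Lemma unflatten_extK : cancel unflatten_ext flatten_ext.
Proof.
move=> x; apply: (can_inj vec_mxK); rewrite mxvecK; apply/row_matrixP => i.
by rewrite rowK ffunE r2vK.
Qed.

Lemma flatten_ext_line (a b : {ffun 'I_N -> K}) (t : K) :
  flatten_ext [ffun i => a i + t * b i] =
  flatten_ext a + flatten_ext [ffun i => t * b i].
Proof.
rewrite /flatten_ext -linearD; congr mxvec; apply/row_matrixP => i.
by rewrite linearD /= !rowK !ffunE linearD.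
Qed.

Lemma flatten_dir_linear (b : {ffun 'I_N -> K}) :
  linear (fun t : L => flatten_ext [ffun i => (t : K) * b i]).
Proof.
move=> c s t; rewrite /flatten_ext -linearP; congr mxvec; apply/row_matrixP => i.
by rewrite linearP /= !rowK !ffunE mulrDl -scalerAl linearP.
Qed.

(** The L-line of direction [b] is a subspace over F of dimension [dim L]. *)
Lemma furstenberg_field_reduction (m : nat) (S : {set 'rV[F]_(N * dim L)}) :
  furstenberg (dim L) m S -> line_furstenberg m (flatten_ext @^-1: S).
Proof.
move=> /forallP SF b b_neq0.
pose psi0 (t : L) := flatten_ext [ffun i => (t : K) * b i].
pose psi : {linear L -> 'rV[F]_(N * dim L)} :=
  HB.pack psi0 (GRing.isLinear.Build F L _ _ psi0 (flatten_dir_linear b)).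
have psi_inj : lker (linfun psi) == 0%VS.
  apply/lker0P => s t; rewrite !lfunE /= => /(can_inj flatten_extK)/ffunP E.
  have [i bi] : exists i, b i != 0.
    apply/existsP; apply: contraR b_neq0; rewrite negb_exists => /forallP b0.
    by apply/eqP/ffunP => i; rewrite ffunE; apply/eqP; rewrite -[_ == _]negbK.
  by have := E i; rewrite !ffunE => /(mulIf bi).
have := SF (limg (linfun psi)).
rewrite limg_dim_eq ?dimvf ?eqxx; last by rewrite (eqP psi_inj) capv0.
case/existsP => v le_m; exists (unflatten_ext v); apply: leq_trans le_m _.
apply: leq_trans (leq_imset_card (fun t : K => v + psi t) _).
apply/subset_leq_card/subsetP => x; rewrite inE => /andP [].
case/imsetP => w /memv_imgP [t _ ->] -> xS; apply/imsetP; exists t.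
  by rewrite !inE flatten_ext_line unflatten_extK; rewrite lfunE in xS.
by rewrite lfunE.
Qed.

Lemma card_flatten_preim (S : {set 'rV[F]_(N * dim L)}) :
  (#|flatten_ext @^-1: S| <= #|S|)%N.
Proof.
rewrite -(card_imset _ (can_inj flatten_extK)); apply/subset_leq_card/subsetP.
by move=> x /imsetP [u]; rewrite inE => uS ->.
Qed.
End FieldReduction.

Lemma furstenberg_bound (F : finFieldType) (N k m : nat)
    (S : {set 'rV[F]_(N * k)}) :
    (0 < N)%N -> (0 < k)%N -> (0 < m)%N -> (m <= #|F| ^ k)%N ->
    furstenberg k m S ->
  (m ^ N <= 2 ^ N * #|S|)%N.
Proof.
move=> N_gt0 k_gt0 m_gt0 le_m SF.
have [L dimL] := exists_fieldExt_dim F k_gt0; rewrite dimvf in dimL.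
move: le_m SF; case: _ / dimL in S * => le_m SF.
apply: leq_trans (leq_mul (leqnn (2 ^ N)) (card_flatten_preim S)).
apply: line_furstenberg_bound => //; last exact: furstenberg_field_reduction.
rewrite -(@card_vspacef F _ (Vector.on (finvect_type L))).
by rewrite (@card_vspace F _ (Vector.on (finvect_type L))) dimvf.
Qed.

Theorem theorem4 (q : nat) (F : finFieldType) (hq : #|F| = q) (n k m : nat)
    (hn : (0 < n)%N) (hk : (0 < k)%N) (hm : (0 < m)%N)
    (hkn : (k < n)%N) (hmq : (m <= q ^ k)%N) (hdvd : (k %| n)%N) :
  (furstenberg_num F n k m)%:R >=
    1 / 2%:R ^+ (n %/ k) * m%:R ^+ (n %/ k) :> rat.
Proof.
rewrite -{}hq in hmq; have [[S SF <-] _] := furstenberg_numP n hmq.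
have [N En] := dvdnP hdvd; subst n.
have N_gt0 : (0 < N)%N by case: N hn {hkn hdvd S SF}.
rewrite mulnK // mul1r ler_pdivrMl ?exprn_gt0 // -!natrX -natrM ler_nat.
exact: furstenberg_bound SF.
Qed.
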